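(* Let $X$ be a non-negative continuous random variable with density $f$, distribution function $F$ and finite mean, and let $X_1,X_2$ be two independent random variables each having distribution function $F$. For $t>0$ with $F(t)>0$ define $$H_t(X,w)=-\frac{1}{2F^2(t)}\int_0^t x\,F^2(x)\,dx .$$ Then $$4H_t(X,w)=-E\big(t^2-\max(X_1,X_2)^2\,\big|\,\max(X_1,X_2)\le t\big).$$
   Context: $H_t(X,w)$ is the weighted dynamic cumulative extropy of $X$. $F^2(t)$ means $(F(t))^2$. *)

(* Defs.v *)
From HB Require Import structures.
From mathcomp Require Import all_boot all_order all_algebra.
From mathcomp Require Import all_classical all_reals all_analysis.

Set Implicit Arguments.
Unset Strict Implicit.
Unset Printing Implicit Defensive.

Import Order.TTheory GRing.Theory Num.Theory.
Import numFieldNormedType.Exports.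

Local Open Scope classical_set_scope.
Local Open Scope ring_scope.

Definition is_density (R : realType) (d : measure_display)
    (T : measurableType d) (P : probability T R) (X : {RV P >-> R})
    (f : R -> R) : Prop :=
  [/\ measurable_fun [set: R] f,
      forall x, 0 <= f x &
      forall A : set R, measurable A ->
        distribution P X A = (\int[lebesgue_measure]_(x in A) (f x)%:E)%E].

Definition independent_RV2 (R : realType) (d : measure_display)
    (T : measurableType d) (P : probability T R) (X Y : {RV P >-> R}) : Prop :=
  forall A B : set R, measurable A -> measurable B ->
    P (X @^-1` A `&` Y @^-1` B) = (P (X @^-1` A) * P (Y @^-1` B))%E.

(* Elementary conditional expectation E(Y | A) = E(Y 1_A) / P(A), meant for
   events with P A > 0. *)
Definition cond_expectation (R : realType) (d : measure_display)
    (T : measurableType d) (P : probability T R) (Y : T -> R) (A : set T)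
    : \bar R :=
  ('E_P[fun w => (Y w * \1_A w)%R] / P A)%E.

(* The library's cdf is \bar R-valued; it is always finite. *)
Definition distr_fun (R : realType) (d : measure_display)
    (T : measurableType d) (P : probability T R) (X : {RV P >-> R}) (x : R)
    : R :=
  fine (cdf X x).

(* Weighted dynamic cumulative extropy, with weight w(x) = x. *)
Definition wdc_extropy (R : realType) (d : measure_display)
    (T : measurableType d) (P : probability T R) (X : {RV P >-> R}) (t : R)
    : \bar R :=
  ((- (1 / (2 * distr_fun X t ^+ 2)))%:E *
   \int[lebesgue_measure]_(x in `[0%R, t]) (x * distr_fun X x ^+ 2)%:E)%E.

(* Main.v *)
Require Import Defs.
From HB Require Import structures.
From mathcomp Require Import all_boot all_order all_algebra.
From mathcomp Require Import all_classical all_reals all_analysis.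
From mathcomp Require Import measurable_realfun ring.

Import Order.TTheory GRing.Theory Num.Theory.
Import numFieldNormedType.Exports.

Local Open Scope classical_set_scope.
Local Open Scope ring_scope.

(** Write M = max(X1, X2). By independence M has distribution function F^2.
    Since M >= 0 almost surely, t^2 - M^2 is the integral of 2x over [M, t]
    on the event M <= t, so Tonelli turns E((t^2 - M^2) 1_{M <= t}) into the
    integral of 2x P(M <= x) = 2x F(x)^2 over [0, t]; dividing by
    P(M <= t) = F(t)^2 gives -4 H_t. *)

Lemma integral_double_id (R : realType) (a b : R) : a <= b ->
  (\int[lebesgue_measure]_(x in `[a, b]) (2 * x)%:E)%E =
  (b ^+ 2 - a ^+ 2)%:E.
Proof.
(* [continuous_FTC2] wants [a < b], so the one-point interval, of measure zero, is split off
   first. *)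
rewrite le_eqVlt => /predU1P[->|ab].
  by rewrite set_itv1 integral_set1 subrr.
have dsq (x : R) : is_derive x 1 (fun y : R => y ^+ 2) (2 * x).
  apply: is_derive_eq; rewrite scaler1 /=; ring.
have csq : continuous (fun y : R => y ^+ 2) by exact: exprn_continuous.
rewrite (@continuous_FTC2 _ (fun x => 2 * x) (fun x => x ^+ 2)) ?EFinB//.
- apply: continuous_subspaceT => x; apply: cvgM; [exact: cvg_cst|exact: cvg_id].
- split => [x _||].
  + by have [] := dsq x.
  + exact/cvg_at_right_filter/csq.
  + exact/cvg_at_left_filter/csq.
- by move=> x _; rewrite derive1E; have [] := dsq x.
Qed.

Lemma measurable_sublevel (R : realType) (d : measure_display)
    (T : measurableType d) (Y : T -> R) (x : R) :
  measurable_fun [set: T] Y -> measurable [set w | Y w <= x].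
Proof.
move=> mY; rewrite -[X in measurable X]setTI.
exact: (@measurable_fun_le _ _ _ _ Y (cst x)).
Qed.

(** A layer-cake formula: both sides are iterated integrals of one nonnegative kernel on the product
    of [T] with the line. It concerns a single variable; independence enters only later, through the
    distribution function of the maximum. *)
Lemma expectation_truncated_sqr (R : realType) (d : measure_display)
    (T : measurableType d) (P : probability T R) (Y : T -> R) (t : R) :
  measurable_fun [set: T] Y -> {ae P, forall w, 0 <= Y w} ->
  ('E_P[fun w => ((t ^+ 2 - Y w ^+ 2) * \1_[set w | Y w <= t] w)%R] =
   \int[lebesgue_measure]_(x in `[0%R, t])
      ((2 * x)%:E * P [set w | (Y w <= x)%R]))%E.
Proof.
move=> mY Y0.
(* The kernel [g] below is [2 * x] on [A]. For [0 <= Y w], the section of [A] at [w] is the interval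
   from [Y w] to [t]; its section at [x] in [[0, t]] is the event [Y <= x]. *)
pose A : set (T * measurableTypeR R) :=
  [set p | Y p.1 <= p.2 /\ (0 <= p.2 <= t)].
have mle x := @measurable_sublevel _ _ _ Y x mY.
have mA : measurable A.
  have m1 : measurable_fun [set: T * measurableTypeR R] (fun p => Y p.1).
    exact: measurableT_comp.
  have m2 : measurable_fun [set: T * measurableTypeR R] (fun p => p.2 : R).
    exact: measurable_snd.
  have -> : A = [set p | Y p.1 <= p.2] `&`
      ([set p | 0 <= p.2] `&` [set p | p.2 <= t]).
    by apply/seteqP; split=> p /= [? /andP].
  rewrite -[X in measurable X]setTI setIA; apply: measurableI.
    exact: measurable_fun_le.
  rewrite -[X in measurable X]setTI setIA; apply: measurableI.
    exact: (@measurable_fun_le _ _ _ _ (cst 0)).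
  exact: measurable_sublevel.
pose g (p : T * measurableTypeR R) : \bar R := (2 * p.2 * \1_A p)%:E.
have g0 p : (0 <= g p)%E.
  rewrite lee_fin indicE; have [|] := boolP (p \in A); last by rewrite mulr0.
  by rewrite inE => -[_ /andP[p0 _]]; rewrite mulr1 mulr_ge0.
have mg : measurable_fun setT g.
  apply/measurable_EFinP; apply: measurable_funM; last exact: measurable_indic.
  by apply: measurable_funM => //; exact: measurable_snd.
rewrite unlock.
transitivity (\int[P]_w \int[lebesgue_measure]_x g (w, x))%E.
  apply: ae_eq_integral => //.
  - apply/measurable_EFinP; apply: measurable_funM; last exact: measurable_indic.
    by apply: measurable_funB => //; exact: measurable_funX.
  - exact: (@measurable_fun_fubini_tonelli_F _ _ _ (measurableTypeR R)
      _ lebesgue_measure g).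
  (* Only almost every [w] works: where [Y w < 0], the section of [A] would start at 0 instead of
     [Y w]. *)
  apply: filterS Y0 => w Yw0 _ /=.
  transitivity (\int[lebesgue_measure]_(x in `[Y w, t]) (2 * x)%:E)%E.
    have [Ywt|tYw] := leP (Y w) t.
      by rewrite integral_double_id// indicE mem_set// mulr1.
    (* When [t < Y w] the interval is empty, and the indicator on the other side vanishes too. *)
    rewrite set_itv_ge ?bnd_simp -?ltNge// integral_set0.
    by rewrite indicE memNset ?mulr0//= leNgt tYw.
  rewrite integral_mkcond; apply: eq_integral => x _.
  rewrite patchE /g indicE /=; case: ifPn.
    rewrite inE/= in_itv/= => /andP[Yx xt].
    by rewrite mem_set ?mulr1//; split=> //=; rewrite xt (le_trans Yw0).
  rewrite notin_setE/= in_itv/= => Yx.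
  by rewrite memNset ?mulr0// => -[/= H1 /andP[_ H2]]; apply: Yx; rewrite H1.
rewrite (@fubini_tonelli _ _ T (measurableTypeR R) R P lebesgue_measure g)//.
rewrite [RHS]integral_mkcond; apply: eq_integral => x _.
rewrite patchE; case: ifPn.
  rewrite inE/= in_itv/= => /andP[x0 xt].
  rewrite -[in RHS](setIT [set w | _]) -integral_indic//.
  rewrite -ge0_integralZl_EFin ?mulr_ge0//.
  2: exact/measurable_EFinP/measurable_indic.
  apply: eq_integral => w _; rewrite /g -EFinM/=; congr (_ * _)%:E.
  rewrite !indicE; congr (nat_of_bool _)%:R.
  by apply/idP/idP; rewrite !inE /A /= x0 xt // => -[].
rewrite notin_setE/= in_itv/= => x0t.
by apply: integral0_eq => w _; rewrite /g indicE memNset ?mulr0// => -[].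
Qed.

Lemma distr_funE (R : realType) (d : measure_display)
    (T : measurableType d) (P : probability T R) (X : {RV P >-> R}) (x : R) :
  (distr_fun X x)%:E = P [set w | X w <= x].
Proof.
rewrite /distr_fun fineK; last exact: fin_num_measure.
rewrite /cdf /distribution /pushforward.
by congr (P _); apply/seteqP; split=> w /=; rewrite in_itv.
Qed.

(** A density rules out an atom at 0, and negative values are negligible by hypothesis. *)
Lemma distr_fun_density0 (R : realType) (d : measure_display)
    (T : measurableType d) (P : probability T R) (X : {RV P >-> R})
    (f : R -> R) :
  is_density X f -> {ae P, forall w, 0 <= X w} -> distr_fun X 0 = 0.
Proof.
move=> [mf f0 Xf] X0; apply: EFin_inj; rewrite distr_funE.
have PX0 : P (X @^-1` [set 0]) = 0%E.
  by have := Xf [set 0] (measurable_set1 0); rewrite integral_set1.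
apply: measure_negligible; first exact: measurable_sublevel.
have : P.-negligible (X @^-1` [set 0] `|` ~` [set w | 0 <= X w]).
  apply: negligibleU => //.
  by apply/negligibleP => //; rewrite -[X @^-1` _]setTI; exact: measurable_funP.
apply: negligibleS => w /= Xw.
have [Xw0|Xw0] := eqVneq (X w) 0; [by left|right=> /= H].
by move/eqP: Xw0; apply; apply/le_anti; rewrite Xw.
Qed.

Theorem mainTheorem10 (R : realType)
    (d : measure_display) (T : measurableType d) (P : probability T R)
    (X : {RV P >-> R}) (f : R -> R)
    (X_density : is_density X f)
    (X_ge0 : {ae P, forall w, 0 <= X w})
    (X_mean : P.-integrable [set: T] (EFin \o X))
    (d' : measure_display) (T' : measurableType d') (Q : probability T' R)
    (X1 X2 : {RV Q >-> R})
    (X1_cdf : forall x, distr_fun X1 x = distr_fun X x)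
    (X2_cdf : forall x, distr_fun X2 x = distr_fun X x)
    (X12_indep : independent_RV2 X1 X2)
    (t : R) (t_gt0 : 0 < t) (Ft_gt0 : 0 < distr_fun X t) :
  (4%:E * wdc_extropy X t)%E =
  (- cond_expectation Q
       (fun w => t ^+ 2 - Num.max (X1 w) (X2 w) ^+ 2)%R
       [set w | (Num.max (X1 w) (X2 w) <= t)%R])%E.
Proof.
have max_cdf x : Q [set w | Num.max (X1 w) (X2 w) <= x] =
    (distr_fun X x ^+ 2)%:E.
  have -> : [set w | Num.max (X1 w) (X2 w) <= x] =
      X1 @^-1` `]-oo, x] `&` X2 @^-1` `]-oo, x].
    by apply/seteqP; split=> w /=; rewrite !in_itv/= ge_max => /andP.
  rewrite X12_indep// expr2 EFinM -{1}X1_cdf -X2_cdf !distr_funE.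
  by congr (Q _ * Q _)%E; apply/seteqP; split=> w /=; rewrite in_itv.
have mM : measurable_fun [set: T'] (fun w => Num.max (X1 w) (X2 w)).
  exact: measurable_maxr.
have M_ge0 : {ae Q, forall w, 0 <= Num.max (X1 w) (X2 w)}.
  (* [X1] and [X2] are tied to [X] only through the distribution function, so their sign is read off
     from it: this event has probability [distr_fun X 0 ^+ 2], which is 0, and it contains every [w]
     where the maximum is negative. *)
  exists [set w | Num.max (X1 w) (X2 w) <= 0]; split.
  - exact: measurable_sublevel.
  - by rewrite max_cdf (distr_fun_density0 _ _ _ _ X f)// expr0n.
  - by move=> w /= /negP; rewrite -ltNge => /ltW.
(* [inver] splits the extended inverse on whether its argument is 0; positivity of [distr_fun X t]
   selects the finite branch. *)
rewrite /cond_expectation expectation_truncated_sqr// max_cdf inver.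
rewrite sqrf_eq0 gt_eqF// /wdc_extropy.
(* Measurability comes from monotonicity; it is needed to pull the factor 2 out of the integral. *)
have mF : measurable_fun [set: R] (distr_fun X).
  apply: measurable_realfun.nondecreasing_measurable => // x y xy.
  by rewrite /distr_fun fine_le ?fin_num_measure// cdf_nondecreasing.
under [in RHS]eq_integral do rewrite max_cdf -EFinM -mulrA EFinM.
rewrite ge0_integralZl_EFin//.
2: move=> x /=; rewrite in_itv/= lee_fin => /andP[? _].
2: by rewrite mulr_ge0 ?sqr_ge0.
2: apply/measurable_funTS/measurable_EFinP/measurable_funM => //.
2: exact: measurable_funX.
set I := (\int[_]_(_ in _) _)%E.
have Fn0 : distr_fun X t != 0 by rewrite gt_eqF.
(* Both sides are now real multiples of the same [I], and the coefficients agree: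
   [4 * - (1 / (2 * F ^+ 2))] equals [- 2 / F ^+ 2], with [F] standing for [distr_fun X t]. *)
rewrite muleA -EFinM -muleN -EFinN muleAC -EFinM.
by congr (_%:E * _)%E; field.
Qed.
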